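(* Let $L$ be a complete lattice and $\mathrm{V}$ a join-dense set of nonzero elements of $L$. (i) If $L$ is an ortholattice with orthocomplementation $\neg$, then $L$ is isomorphic to $\mathfrak{L}(\mathrm{V},\vartriangleleft^\neg_{\mathrm{V}})$. (ii) If $L$ is a Heyting algebra with pseudocomplementation $\neg a=a\to 0$, and $\mathrm{V}=CJI(L)$, then $L$ is isomorphic to $\mathfrak{L}(\mathrm{V},\vartriangleleft^\neg_{\mathrm{V}})$. (iii) If $\neg$ is an anti-inflationary operation on $L$ such that $L$ has compatible escape in $\mathrm{V}$ with $\neg$, and $\vartriangleleft^\neg_{\mathrm{V}}$ satisfies the second suitability condition, then $L$ is isomorphic to $\mathfrak{L}(\mathrm{V},\vartriangleleft^\neg_{\mathrm{V}})$.
   Context: A relational frame is a pair $(X,\vartriangleleft)$ with $X$ a nonempty set and $\vartriangleleft$ a binary relation on $X$. Write $y\vartriangleright x$ for $x\vartriangleleft y$, and for $A\subseteq X$ let $c_\vartriangleleft(A)=\{x\in X\mid \forall x'\vartriangleleft x\ \exists x''\vartriangleright x':\ x''\in A\}$. This is a closure operator on $\wp(X)$. A $c_\vartriangleleft$-fixpoint is an $A\subseteq X$ with $c_\vartriangleleft(A)=A$. $\mathfrak{L}(X,\vartriangleleft)$ is the complete lattice of $c_\vartriangleleft$-fixpoints ordered by $\subseteq$ (meets are intersections; $\bigvee A_i=c_\vartriangleleft(\bigcup A_i)$). A set $\mathrm{V}\subseteq L$ is join-dense if every element of $L$ is the join of some subset of $\mathrm{V}$. $CJI(L)$ is the set of completely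 join-irreducible elements of $L$. An ortholattice is a bounded lattice with an orthocomplementation, i.e. a unary operation $\neg$ that is antitone ($a\le b\Rightarrow\neg b\le\neg a$), involutive ($\neg\neg a=a$), and a complementation ($a\wedge\neg a=0$, $a\vee\neg a=1$). A unary operation $\neg$ on $L$ is anti-inflationary if $a\not\leq\neg a$ for all nonzero $a\in L$. Let $\neg$ be an anti-inflationary operation on $L$ and $\mathrm{V}$ a set of nonzero elements of $L$. For $a,b\in L$, $a$ escapes $b$ in $\mathrm{V}$ with $\neg$ if there is $c\in\mathrm{V}$ with $a\not\leq\neg c$ and $b\leq\neg c$. The relation $\vartriangleleft^\neg_{\mathrm{V}}$ on $\mathrm{V}$ is defined by: $x\vartriangleleft^\neg_{\mathrm{V}}y$ iff $y\not\leq\neg x$ and, for all $z\in L$, if $y\leq z$ and $x\not\leq z$, then $x$ escapes $z$ in $\mathrm{V}$ with $\neg$. For $a\in\mathrm{V}$, $b\in L$, $a$ compatibly escapes $b$ in $\mathrm{V}$ with $\neg$ if there is $c\in\mathrm{V}$ with $c\vartriangleleft^\neg_{\mathrm{V}}a$ and $b\leq\neg c$. $L$ has compatible escape in $\mathrm{V}$ with $\neg$ if for all $a\in\mathrm{V}$, $b\in L$, if $a$ escapes $b$ in $\mathrm{V}$ with $\neg$, then $a$ compatibly escapes $b$ in $\mathrm{V}$ with $\neg$. A relation $\vartriangleleft$ on $\mathrm{V}$ satisfies the second suitability condition (for $L$) if: whenever $a\in\mathrm{V}$, $B$ is a $c_\vartriangleleft$-fixpoint of $(\mathrm{V},\vartriangleleft)$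 with a join $b$ in $L$, and $a\leq b$, then $a\in B$. *)

(* Defs.v *)
From HB Require Import structures.
From mathcomp Require Import all_boot all_order.
From mathcomp Require Import boolp classical_sets.

Set Implicit Arguments.
Unset Strict Implicit.
Unset Printing Implicit Defensive.
Import Order.TTheory.

Local Open Scope classical_set_scope.

Section FrameLattice.
Context {X : Type}.
Implicit Types (r : X -> X -> Prop) (A B : set X).

(* [r x y] reads "x <| y"; the carrier is not required to be inhabited *)
Definition frame_closure r A : set X :=
  [set x | forall x', r x' x -> exists2 x'', r x' x'' & A x''].

Definition is_fixpoint r A : Prop := frame_closure r A = A.

Definition frame_lattice r : Type := {A : set X | `[< is_fixpoint r A >]}.

Lemma sub_frame_closure r A : A `<=` frame_closure r A.
Proof. by move=> x Ax x' x'x; exists x. Qed.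

Lemma frame_closure_sub r A B :
  A `<=` B -> frame_closure r A `<=` frame_closure r B.
Proof. by move=> AB x clx x' /clx[x'' x'x'' /AB]; exists x''. Qed.

Lemma frame_closureK r A : is_fixpoint r (frame_closure r A).
Proof.
apply/seteqP; split; last exact: sub_frame_closure.
move=> x clx x' /clx[y x'y cly]; exact: cly.
Qed.

Lemma is_fixpoint_bigcap r (F : set (set X)) :
  (forall A, F A -> is_fixpoint r A) ->
  is_fixpoint r [set x | forall A, F A -> A x].
Proof.
move=> fixF; apply/seteqP; split; last exact: sub_frame_closure.
move=> x clx A FA; rewrite -(fixF A FA).
by apply: frame_closure_sub clx => y; apply.
Qed.

Lemma is_fixpointI r A B :
  is_fixpoint r A -> is_fixpoint r B -> is_fixpoint r (A `&` B).
Proof.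
move=> fA fB; apply/seteqP; split; last exact: sub_frame_closure.
by move=> x clx; split; [rewrite -fA|rewrite -fB];
  apply: frame_closure_sub clx => y [].
Qed.

Lemma is_fixpointT r : is_fixpoint r setT.
Proof. by apply/seteqP; split=> //; exact: sub_frame_closure. Qed.

End FrameLattice.

Fact frame_display : Order.disp_t. Proof. by []. Qed.

Section FrameLatticeOrder.
Context (X : Type) (r : X -> X -> Prop).
Local Notation L := (frame_lattice r).

HB.instance Definition _ := [isSub of L for @sval _ _].
HB.instance Definition _ := [Choice of L by <:].
HB.instance Definition _ :=
  [SubChoice_isSubPOrder of L by <: with frame_display].

Implicit Types a b c : L.

Lemma frame_latticeP a : is_fixpoint r (val a).
Proof. by have /asboolP := valP a. Qed.

Lemma frame_leP a b : reflect (val a `<=` val b) (a <= b)%O.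
Proof. by rewrite -Order.le_val; exact: subsetPset. Qed.

Definition frame_mk (A : set X) (fA : is_fixpoint r A) : L :=
  Sub A (introT (asboolP _) fA).

Lemma val_frame_mk A (fA : is_fixpoint r A) : val (frame_mk fA) = A.
Proof. exact: SubK. Qed.

Definition frame_meet a b : L :=
  frame_mk (is_fixpointI (frame_latticeP a) (frame_latticeP b)).

Definition frame_join a b : L := frame_mk (frame_closureK r (val a `|` val b)).

Lemma frame_meetP c a b : (c <= frame_meet a b)%O = (c <= a)%O && (c <= b)%O.
Proof.
apply/frame_leP/andP; rewrite val_frame_mk.
  by rewrite subsetI => -[? ?]; split; exact/frame_leP.
by move=> [/frame_leP ca /frame_leP cb]; rewrite subsetI.
Qed.

Lemma frame_closure_le (A : set X) c :
  frame_closure r A `<=` val c <-> A `<=` val c.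
Proof.
split; first exact: subset_trans (@sub_frame_closure _ r A).
by move=> Ac; rewrite -[val c]frame_latticeP; exact: frame_closure_sub.
Qed.

Lemma frame_joinP a b c : (frame_join a b <= c)%O = (a <= c)%O && (b <= c)%O.
Proof.
apply/frame_leP/andP; rewrite val_frame_mk frame_closure_le subUset.
  by move=> [? ?]; split; exact/frame_leP.
by move=> [/frame_leP ? /frame_leP ?].
Qed.

HB.instance Definition _ := Order.POrder_MeetJoin_isLattice.Build
  frame_display L frame_meetP frame_joinP.

Definition frame_bot : L := frame_mk (frame_closureK r set0).
Definition frame_top : L := frame_mk (is_fixpointT r).

Lemma frame_le0x a : (frame_bot <= a)%O.
Proof. by apply/frame_leP; rewrite val_frame_mk frame_closure_le. Qed.

Lemma frame_lex1 a : (a <= frame_top)%O.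
Proof. by apply/frame_leP; rewrite val_frame_mk. Qed.

HB.instance Definition _ := Order.hasBottom.Build frame_display L frame_le0x.
HB.instance Definition _ := Order.hasTop.Build frame_display L frame_lex1.

Lemma frame_supremum (F : set L) :
  supremums F (frame_mk (frame_closureK r (\bigcup_(a in F) val a))).
Proof.
split=> [a Fa|b ubb]; apply/frame_leP; rewrite val_frame_mk.
  by move=> x ax; apply: sub_frame_closure; exists a.
by rewrite frame_closure_le => x [a Fa ax]; have /frame_leP := ubb _ Fa; apply.
Qed.

Lemma frame_infimum (F : set L) :
  exists2 m : L, val m = \bigcap_(a in F) val a & infimums F m.
Proof.
have fixm : is_fixpoint r (\bigcap_(a in F) val a).
  have := @is_fixpoint_bigcap _ r (val @` F).
  have -> : [set x | forall A, (val @` F) A -> A x] = \bigcap_(a in F) val a.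
    apply/seteqP; split=> x h; first by move=> a Fa; apply: h; exists a.
    by move=> _ [a Fa <-]; exact: h.
  by apply=> _ [a _ <-]; exact: frame_latticeP.
exists (frame_mk fixm); rewrite ?val_frame_mk //.
split=> [a Fa|b lbb]; apply/frame_leP; rewrite val_frame_mk.
  by move=> x; apply.
by move=> x bx a Fa; have /frame_leP := lbb _ Fa; apply.
Qed.

End FrameLatticeOrder.

(* an order isomorphism, hence one preserving all existing joins and meets *)
Definition lattice_isomorphic d d' (L : latticeType d) (M : latticeType d') :
    Prop :=
  exists2 f : L -> M, bijective f & {mono f : a b / (a <= b)%O}.

Section LatticeNotions.
Context {d : Order.disp_t} {L : tbLatticeType d}.
Implicit Types (V : set L) (neg : L -> L).

Definition complete_lattice (M : tbLatticeType d) : Prop :=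
  forall A : set M, supremums A !=set0 /\ infimums A !=set0.

Definition join_dense V : Prop :=
  forall a : L, exists2 A : set L, A `<=` V & supremums A a.

(* [A] may be empty, so [\bot] is excluded *)
Definition CJI : set L := [set a | forall A : set L, supremums A a -> A a].

Record orthocomplementation neg : Prop := {
  ortho_antitone : forall a b, (a <= b)%O -> (neg b <= neg a)%O;
  ortho_involutive : forall a, neg (neg a) = a;
  ortho_meet : forall a, (a `&` neg a)%O = \bot%O;
  ortho_join : forall a, (a `|` neg a)%O = \top%O
}.

(* the lattice is a Heyting algebra iff such an [imp] exists; [imp] is unique *)
Definition heyting_implication (imp : L -> L -> L) : Prop :=
  forall a b c : L, (c <= imp a b)%O = (c `&` a <= b)%O.

Definition anti_inflationary neg : Prop :=
  forall a : L, a <> \bot%O -> ~~ (a <= neg a)%O.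

Definition escapes V neg (a b : L) : Prop :=
  exists2 c, V c & ~~ (a <= neg c)%O /\ (b <= neg c)%O.

Definition escape_rel V neg (x y : V) : Prop :=
  ~~ (val y <= neg (val x))%O /\
  forall z : L, (val y <= z)%O -> ~~ (val x <= z)%O -> escapes V neg (val x) z.

Definition compatibly_escapes V neg (a : V) (b : L) : Prop :=
  exists2 c : V, escape_rel neg c a & (b <= neg (val c))%O.

Definition compatible_escape V neg : Prop :=
  forall (a : V) (b : L), escapes V neg (val a) b -> compatibly_escapes neg a b.

Definition second_suitability V (r : V -> V -> Prop) : Prop :=
  forall (a : V) (B : set V) (b : L), is_fixpoint r B ->
    supremums (val @` B) b -> (val a <= b)%O -> B a.

End LatticeNotions.

(* Main.v *)
Require Import Defs.
From mathcomp Require Import all_boot all_order.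
From mathcomp Require Import boolp classical_sets.

(** An element [a] of [L] is represented by the set [down V a] of the members
    of [V] below it; join-density makes [down V] an order embedding into the
    powerset of [V], so everything rests on its image being exactly the set
    of fixpoints of the closure.

    [down V a] is a fixpoint under compatible escape ([is_fixpoint_down]).
    Let [x] be in its closure, and suppose [x] is not below [a].  An
    anti-inflationary [neg] makes the relation reflexive, so the closure
    condition at [x] itself yields some [x''] with [x] related to [x''] and
    [x'' <= a]; the second half of the definition of the relation then says
    that [x] escapes [a].  By compatible escape there is [c] related to [x]
    with [a <= neg c].  The closure condition at [c] yields some [y <= a] to
    which [c] is related, hence with [y] not below [neg c]: a contradiction.

    Conversely, a fixpoint [B] with join [b] satisfies [B = down V b], one
    inclusion being the second suitability condition.  This is part (iii)
    ([compatible_escape_isomorphic]), and the other parts are instances.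

    In an ortholattice, join-density applied to complements shows that [a]
    escapes [b] as soon as [a] is not below [b], so the relation reduces to
    [y] not being below [neg x] ([escape_rel_ortho]); both conditions follow.

    In a Heyting algebra an escape witness [c] of [a] can be shrunk to a
    member of [V] below [a `&` c], and anything in [V] below [a] is related
    to [a]; this is compatible escape.  For suitability, meets distribute over
    existing joins, so a completely join-irreducible element below the join of
    [B] is below a member of [B], and fixpoints are down-closed because the
    relation is upward closed in its second argument ([escape_rel_trans]). *)

Set Implicit Arguments.
Unset Strict Implicit.
Unset Printing Implicit Defensive.
Import Order.TTheory.

Local Open Scope classical_set_scope.
Local Open Scope order_scope.

Section Representation.
Context {d : Order.disp_t} {L : tbLatticeType d} {V : set L}.
Implicit Types (a b c : L) (x y z : V) (neg : L -> L).

Definition down a : set V := [set x | val x <= a].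

Lemma valV x : V (val x).
Proof. exact: set_mem (valP x). Qed.

Lemma subV a : V a -> exists x : V, val x = a.
Proof. by move=> Va; exists (Sub a (mem_set Va)); rewrite SubK. Qed.

Lemma not_supremum_le (A : set L) a b :
  supremums A a -> ~~ (a <= b) -> exists2 c, A c & ~~ (c <= b).
Proof.
move=> [_ lea] nab; apply: contrapT => nex.
move/negP: nab; apply; apply: lea => c Ac.
by apply: contrapT => /negP ncb; apply: nex; exists c.
Qed.

Lemma join_dense_separation a b :
  join_dense V -> ~~ (a <= b) -> exists2 x : V, val x <= a & ~~ (val x <= b).
Proof.
move=> /(_ a)[A AV supA] /(not_supremum_le supA)[c Ac ncb].
have [x xc] := subV (AV _ Ac); exists x; rewrite xc //.
by case: supA => uba _; exact: uba.
Qed.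

Lemma sub_down a b :
  join_dense V -> (down a `<=` down b) <-> (a <= b).
Proof.
move=> dV; split=> [ab|ab x xa]; last exact: le_trans xa ab.
apply: contrapT => /negP /(join_dense_separation dV)[x xa /negP].
by apply; exact: ab.
Qed.

(** The main source of related pairs: when [x] is below [y], the escape clause
    of the relation is vacuous.  It gives reflexivity from anti-inflation, and
    relates [a] to the shrunk witnesses in the Heyting case. *)
Lemma escape_rel_le neg x y :
  val x <= val y -> ~~ (val y <= neg (val x)) -> escape_rel neg x y.
Proof.
by move=> xy nyx; split=> // c yc; rewrite (le_trans xy yc).
Qed.

Lemma escape_rel_trans neg x y z :
  escape_rel neg x y -> val y <= val z -> escape_rel neg x z.
Proof.
move=> [nyx escx] yz; split=> [|c zc]; last exact/escx/(le_trans yz).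
by apply: contra nyx; exact: le_trans.
Qed.

Lemma is_fixpoint_down neg a :
  (forall x : V, val x <> \bot) ->
  anti_inflationary neg -> compatible_escape V neg ->
  is_fixpoint (@escape_rel d L V neg) (down a).
Proof.
move=> V0 aneg cV; apply/seteqP; split; last exact: sub_frame_closure.
move=> x clx; apply: contrapT => /negP nxa.
have xx : escape_rel neg x x by apply: escape_rel_le => //; exact: aneg.
have [x'' [_ escx] x''a] := clx x xx.
have [c cx ac] := cV x a (escx a x''a nxa).
have [y [nyc _] ya] := clx c cx.
by move/negP: nyc; apply; exact: le_trans ya ac.
Qed.

Lemma compatible_escape_isomorphic neg :
  complete_lattice L -> join_dense V -> (forall x : V, val x <> \bot) ->
  anti_inflationary neg -> compatible_escape V neg ->
  second_suitability (@escape_rel d L V neg) ->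
  lattice_isomorphic L (frame_lattice (@escape_rel d L V neg)).
Proof.
move=> cL dV V0 aneg cV sV.
pose f a := frame_mk (is_fixpoint_down a V0 aneg cV).
have fmono : {mono f : a b / a <= b}.
  by move=> a b; apply/frame_leP/idP; rewrite !val_frame_mk (sub_down _ _ dV).
have fsurj B : exists a, f a = B.
  have [[b supb] _] := cL (val @` val B); exists b.
  apply/val_inj; rewrite val_frame_mk; apply/seteqP; split=> x.
    exact: sV (frame_latticeP B) supb.
  by move=> Bx; case: supb => ubb _; apply: ubb; exists x.
have [g gK] := choice fsurj.
by exists f => //; exists g => // a; apply: (inc_inj fmono); rewrite gK.
Qed.

Section Ortholattice.
Context {neg : L -> L}.
Hypotheses (dV : join_dense V) (negO : orthocomplementation neg).

Lemma ortho_le_negC a b : a <= neg b -> b <= neg a.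
Proof. by move=> /(ortho_antitone negO); rewrite ortho_involutive. Qed.

Lemma anti_inflationary_ortho : anti_inflationary neg.
Proof.
move=> a a0; apply/negP => ana; apply: a0.
by rewrite -(ortho_meet negO a); apply/esym/meet_idPl.
Qed.

Lemma escapes_ortho a b : ~~ (a <= b) -> escapes V neg a b.
Proof.
move=> nab.
have /(join_dense_separation dV)[x xb nxa] : ~~ (neg b <= neg a).
  by apply: contra nab => /(ortho_antitone negO); rewrite !ortho_involutive.
exists (val x); first exact: valV.
by split; [apply: contra nxa|]; exact: ortho_le_negC.
Qed.

Lemma escape_rel_ortho x y :
  escape_rel neg x y <-> ~~ (val y <= neg (val x)).
Proof. by split=> [[]//|nyx]; split=> // c _; exact: escapes_ortho. Qed.

Lemma compatible_escape_ortho : compatible_escape V neg.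
Proof.
move=> x b [_ /subV[y <-] [nxy byx]].
by exists y => //; apply/escape_rel_ortho.
Qed.

Lemma second_suitability_ortho : second_suitability (@escape_rel d L V neg).
Proof.
move=> x B b fB supb xb; rewrite -fB => x' /escape_rel_ortho nxx'.
have /(not_supremum_le supb)[_ [y By <-] nyx'] : ~~ (b <= neg (val x')).
  by apply: contra nxx'; exact: le_trans.
by exists y => //; apply/escape_rel_ortho.
Qed.

End Ortholattice.

Section Heyting.
Context {imp : L -> L -> L}.
Hypothesis impP : heyting_implication imp.
Local Notation neg := (fun a => imp a \bot).

Lemma anti_inflationary_heyting : anti_inflationary neg.
Proof.
by move=> a a0; rewrite impP meetxx lex0; apply/eqP.
Qed.

Lemma compatible_escape_heyting :
  join_dense V -> (forall x : V, val x <> \bot) -> compatible_escape V neg.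
Proof.
move=> dV V0 x b [c _ []]; rewrite !impP => nxc bc.
have [y yxc _] := join_dense_separation dV nxc.
move: yxc; rewrite lexI => /andP[yx yc]; exists y.
  apply: escape_rel_le => //.
  by rewrite impP (meet_idPr yx) lex0; apply/eqP; exact: V0.
by rewrite impP; apply: le_trans bc; exact: leI2.
Qed.

(** Complete join-irreducibility upgrades to complete join-primeness: the
    family of meets with [a] has join [a] by residuation. *)
Lemma CJI_heyting_prime (A : set L) a b :
  CJI a -> supremums A b -> a <= b -> exists2 c, A c & a <= c.
Proof.
move=> cjia [ubb leb] ab.
have [c Ac /meet_idPl ac] : ((fun c => a `&` c) @` A) a.
  apply: cjia; split=> [_ [c _ <-]|u ubu]; first exact: leIl.
  have : b <= imp a u.
    by apply: leb => c Ac; rewrite impP meetC; apply: ubu; exists c.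
  by rewrite impP (meet_idPr ab).
by exists c.
Qed.

Lemma second_suitability_heyting :
  V `<=` CJI -> second_suitability (@escape_rel d L V neg).
Proof.
move=> VCJI x B b fB supb xb; rewrite -fB => x' x'x.
have [_ [y By <-] xy] := CJI_heyting_prime (VCJI _ (valV x)) supb xb.
by exists y => //; exact: escape_rel_trans x'x xy.
Qed.

End Heyting.

End Representation.

Theorem theorem3p11 (d : Order.disp_t) (L : tbLatticeType d) (V : set L) :
  complete_lattice L ->
  join_dense V ->
  (forall x : L, V x -> x <> \bot%O) ->
  [/\ (* (i) *)
      forall neg : L -> L,
        orthocomplementation neg ->
        lattice_isomorphic L (frame_lattice (@escape_rel d L V neg)),
      (* (ii) *)
      forall imp : L -> L -> L,
        heyting_implication imp ->
        V = CJI ->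
        lattice_isomorphic L
          (frame_lattice (@escape_rel d L V (fun a => imp a \bot%O)))
    & (* (iii) *)
      forall neg : L -> L,
        anti_inflationary neg ->
        compatible_escape V neg ->
        second_suitability (@escape_rel d L V neg) ->
        lattice_isomorphic L (frame_lattice (@escape_rel d L V neg))].
Proof.
move=> cL dV V0; have {}V0 (x : V) : val x <> \bot by exact/V0/valV.
split=> [neg negO|imp impP VCJI|neg aneg cV sV].
- apply: compatible_escape_isomorphic => //.
  + exact: anti_inflationary_ortho.
  + exact: compatible_escape_ortho.
  + exact: second_suitability_ortho.
- apply: compatible_escape_isomorphic => //.
  + exact: anti_inflationary_heyting.
  + exact: compatible_escape_heyting.
  + by apply: second_suitability_heyting => //; rewrite VCJI.
- exact: compatible_escape_isomorphic.
Qed.
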